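(* Let $L(V)$ be the Kantor Lie-double of the Virasoro-like algebra, and let $\Delta_{\overline 1}(L(V))$ be the space of odd $(-1)$-superderivations of $L(V)$. Then $\Delta_{\overline 1}(L(V))=\{0\}$.
   Context: For $\mathbf{m}=(m_1,m_2),\mathbf{n}=(n_1,n_2)\in\mathbb{Z}^2$ write $\det\binom{\mathbf{n}}{\mathbf{m}}=n_1m_2-n_2m_1$. The Kantor Lie-double $L(V)=L(V)_{\overline 0}\oplus L(V)_{\overline 1}$ of the Virasoro-like algebra is the complex Lie superalgebra whose even part $L(V)_{\overline 0}$ has basis $\{L_{\mathbf{m}}\mid\mathbf{m}\in\mathbb{Z}^2\setminus\{\mathbf{0}\}\}$, whose odd part $L(V)_{\overline 1}$ has basis $\{G_{\mathbf{m}}\mid\mathbf{m}\in\mathbb{Z}^2\setminus\{\mathbf{0}\}\}$, and whose bracket is $[L_{\mathbf{m}},L_{\mathbf{n}}]=\det\binom{\mathbf{n}}{\mathbf{m}}L_{\mathbf{m}+\mathbf{n}}$, $[L_{\mathbf{m}},G_{\mathbf{n}}]=\det\binom{\mathbf{n}}{\mathbf{m}}G_{\mathbf{m}+\mathbf{n}}=[G_{\mathbf{m}},L_{\mathbf{n}}]$, $[G_{\mathbf{m}},G_{\mathbf{n}}]=L_{\mathbf{m}+\mathbf{n}}$, with the convention $L_{\mathbf{0}}=0$, $G_{\mathbf{0}}=0$. For $\delta\in\mathbb{C}$, a $\delta$-superderivation of a Lie superalgebra $L$ is a homogeneous (with respect to the $\mathbb{Z}_2$-grading) linear map $D:L\to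 L$ of degree $|D|$ with $D([x,y])=\delta([D(x),y]+(-1)^{|D||x|}[x,D(y)])$ for all homogeneous $x,y\in L$. It is odd if $|D|=\overline 1$, i.e. $D(L_{\overline 0})\subseteq L_{\overline 1}$ and $D(L_{\overline 1})\subseteq L_{\overline 0}$. *)

(* Defs.v *)
From HB Require Import structures.
From mathcomp Require Import all_boot all_order all_algebra.
From mathcomp Require Import ring.
From mathcomp Require Import classical_sets functions reals complex.
From mathcomp Require Import finmap monalg.

Set Implicit Arguments.
Unset Strict Implicit.
Unset Printing Implicit Defensive.

Import GRing.Theory.
Local Open Scope ring_scope.

(* Degrees in Z_2 are booleans: [false] is even, [true] is odd, [(+)] is the
   sum and [&&] the product, so that (-1)^(p q) is [(-1) ^+ (p && q)]. *)
HB.mixin Record Lmodule_isLieSuperalgebra (K : numFieldType) L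
    of GRing.Lmodule K L := {
  homog : bool -> set L;
  sbracket : L -> L -> L;
  homog0 : forall p, homog p 0;
  homogP : forall p (a : K) x y, homog p x -> homog p y -> homog p (a *: x + y);
  homog_span : forall x, exists x0 x1,
    [/\ homog false x0, homog true x1 & x = x0 + x1];
  homog_direct : forall x, homog false x -> homog true x -> x = 0;
  sbracketPl : forall (a : K) x y z,
    sbracket (a *: x + y) z = a *: sbracket x z + sbracket y z;
  sbracketPr : forall (a : K) x y z,
    sbracket z (a *: x + y) = a *: sbracket z x + sbracket z y;
  homog_sbracket : forall p q x y,
    homog p x -> homog q y -> homog (p (+) q) (sbracket x y);
  sbracketC : forall p q x y, homog p x -> homog q y ->
    sbracket x y = - ((-1) ^+ (p && q) *: sbracket y x);
  sbracket_jacobi : forall p q x y z, homog p x -> homog q y ->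
    sbracket x (sbracket y z) =
    sbracket (sbracket x y) z + (-1) ^+ (p && q) *: sbracket y (sbracket x z)
}.

#[short(type="lieSuperalgType")]
HB.structure Definition LieSuperalgebra (K : numFieldType) :=
  { L of GRing.Lmodule K L & Lmodule_isLieSuperalgebra K L }.

Definition superderivations (K : numFieldType) (L : lieSuperalgType K)
    (delta : K) (d : bool) : set (L -> L) :=
  [set D | [/\ linear D,
     forall p x, homog p x -> homog (d (+) p) (D x) &
     forall p q x y, homog p x -> homog q y ->
       D (sbracket x y) =
       delta *: (sbracket (D x) y + (-1) ^+ (d && p) *: sbracket x (D y))]].
Arguments superderivations {K} L delta d.

Section FreeModule.
Variables (K : numFieldType) (I : choiceType) (V : lmodType K).
Implicit Types x y z : {malg K[I]}.

Definition bilift (f : I -> I -> V) x y : V :=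
  \sum_(i <- msupp x) \sum_(j <- msupp y) (x@_i * y@_j) *: f i j.

Lemma suml_linear (f : I -> V) (a : K) x y :
  \sum_(i <- msupp (a *: x + y)) (a *: x + y)@_i *: f i =
  a *: (\sum_(i <- msupp x) x@_i *: f i) + \sum_(i <- msupp y) y@_i *: f i.
Proof.
have widen (D : {fset I}) z : (msupp z `<=` D)%fset ->
    \sum_(i <- msupp z) z@_i *: f i = \sum_(i <- D) z@_i *: f i.
  move=> sD; apply: big_fset_incl => // i _ iN.
  by rewrite mcoeff_outdom // scale0r.
set D := (msupp (a *: x + y) `|` (msupp x `|` msupp y))%fset.
rewrite (widen D (a *: x + y)) ?fsubsetUl //.
rewrite (widen D x); last by rewrite /D fsetUCA fsubsetUl.
rewrite (widen D y); last by rewrite /D fsetUA fsubsetUr.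
rewrite scaler_sumr -big_split /=; apply: eq_bigr => i _.
by rewrite mcoeffD mcoeffZ scalerDl scalerA.
Qed.

Lemma biliftPl f a x y z :
  bilift f (a *: x + y) z = a *: bilift f x z + bilift f y z.
Proof.
have E t : bilift f t z =
    \sum_(i <- msupp t) t@_i *: \sum_(j <- msupp z) z@_j *: f i j.
  apply: eq_bigr => i _; rewrite scaler_sumr.
  by apply: eq_bigr => j _; rewrite scalerA.
by rewrite !E suml_linear.
Qed.

Lemma biliftPr f a x y z :
  bilift f z (a *: x + y) = a *: bilift f z x + bilift f z y.
Proof.
have E t : bilift f z t =
    \sum_(j <- msupp t) t@_j *: \sum_(i <- msupp z) z@_i *: f i j.
  rewrite /bilift exchange_big /=; apply: eq_bigr => i _; rewrite scaler_sumr.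
  by apply: eq_bigr => j _; rewrite scalerA mulrC.
by rewrite !E suml_linear.
Qed.

Lemma biliftUU f i j : bilift f << i >> << j >> = f i j.
Proof.
by rewrite /bilift !msuppU oner_eq0 !big_seq_fset1 !mcoeffUU mulr1 scale1r.
Qed.

Lemma bilift0l f y : bilift f 0 y = 0.
Proof. by rewrite /bilift msupp0 big_seq_fset0. Qed.

Lemma bilift0r f x : bilift f x 0 = 0.
Proof. by rewrite /bilift big1 // => i _; rewrite msupp0 big_seq_fset0. Qed.

Lemma biliftDl f x y z : bilift f (x + y) z = bilift f x z + bilift f y z.
Proof. by have := biliftPl f 1 x y z; rewrite !scale1r. Qed.

Lemma biliftDr f x y z : bilift f z (x + y) = bilift f z x + bilift f z y.
Proof. by have := biliftPr f 1 x y z; rewrite !scale1r. Qed.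

Lemma biliftZl f a x z : bilift f (a *: x) z = a *: bilift f x z.
Proof. by have := biliftPl f a x 0 z; rewrite bilift0l !addr0. Qed.

Lemma biliftZr f a x z : bilift f z (a *: x) = a *: bilift f z x.
Proof. by have := biliftPr f a x 0 z; rewrite bilift0r !addr0. Qed.

Lemma malg_ext (f g : {malg K[I]} -> V) : linear f -> linear g ->
  (forall i, f << i >> = g << i >>) -> forall x, f x = g x.
Proof.
move=> lf lg fg x; rewrite [x]monalgE.
have lin0 h : linear h -> h 0 = 0 :> V.
  move=> lh; have := lh (-1) 0 0.
  by rewrite scaler0 addr0 scaleN1r addNr.
elim: (enum_fset (msupp x)) => [|i s IH].
  by rewrite !big_nil !lin0.
rewrite !big_cons; have -> : << x@_i *g i >> = x@_i *: << i >> :> {malg K[I]}.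
  by apply/malgP => k; rewrite mcoeffZ !mcoeffU mulrnAr mulr1.
by rewrite lf lg IH fg.
Qed.

End FreeModule.

Notation Z2 := (int * int)%type.

Definition Z2star : choiceType := {m : Z2 | m != 0}.

Definition det2 (n m : Z2) : int := n.1 * m.2 - n.2 * m.1.

Section Double.
Variable K : numFieldType.
Local Notation M := {malg K[Z2star]}.
Implicit Types (x y z : M) (m n : Z2).

(* The basis vector of index m, with the convention that it is 0 for m = 0. *)
Definition bvec m : M := if insub m is Some i then << i >> else 0.

Definition lie_part : M -> M -> M := bilift (fun i j : Z2star =>
  (det2 (val j) (val i))%:~R *: bvec (val i + val j)).

Definition mul_part : M -> M -> M := bilift (fun i j : Z2star =>
  bvec (val i + val j)).

(* The first component is the even part and the second one the odd part. *)
Definition virasoro_double : Type := (M * M)%type.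

HB.instance Definition _ := GRing.Lmodule.on virasoro_double.

Definition double_L m : virasoro_double := (bvec m, 0).
Definition double_G m : virasoro_double := (0, bvec m).

Definition double_homog (p : bool) : set virasoro_double :=
  [set u | if p then u.1 = 0 else u.2 = 0].

Definition double_bracket (u v : virasoro_double) : virasoro_double :=
  (lie_part u.1 v.1 + mul_part u.2 v.2, lie_part u.1 v.2 + lie_part u.2 v.1).

Lemma bvec0 : bvec 0 = 0.
Proof. by rewrite /bvec insubN ?eqxx. Qed.

Lemma bvec_val (i : Z2star) : bvec (val i) = << i >>.
Proof. by rewrite /bvec valK. Qed.

Lemma lie_bvec m n :
  lie_part (bvec m) (bvec n) = (det2 n m)%:~R *: bvec (m + n).
Proof.
have [->|m0] := eqVneq m 0.
  by rewrite bvec0 /lie_part bilift0l /det2 !mulr0 subr0 scale0r.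
have [->|n0] := eqVneq n 0.
  by rewrite bvec0 /lie_part bilift0r /det2 !mul0r subr0 scale0r.
rewrite -[m]/(val (Sub m m0 : Z2star)) -[n]/(val (Sub n n0 : Z2star)).
by rewrite !bvec_val /lie_part biliftUU.
Qed.

Lemma mul_bvec m n : m != 0 -> n != 0 ->
  mul_part (bvec m) (bvec n) = bvec (m + n).
Proof.
move=> m0 n0.
rewrite -[m]/(val (Sub m m0 : Z2star)) -[n]/(val (Sub n n0 : Z2star)).
by rewrite !bvec_val /mul_part biliftUU.
Qed.

Lemma mul_bvec_scale (c : int) m n : (m = 0 -> c = 0) -> (n = 0 -> c = 0) ->
  c%:~R *: mul_part (bvec m) (bvec n) = c%:~R *: bvec (m + n).
Proof.
have [->|m0] := eqVneq m 0; first by move=> ->; rewrite ?scale0r.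
have [->|n0] := eqVneq n 0; first by move=> _ ->; rewrite ?scale0r.
by rewrite mul_bvec.
Qed.

Let biE := (@biliftDl, @biliftDr, @biliftZl, @biliftZr, @bilift0l, @bilift0r).

Lemma lieC x y : lie_part x y = - lie_part y x.
Proof.
move: x; apply: malg_ext => [a u v|a u v|i].
- exact: biliftPl.
- by rewrite /lie_part biliftPr opprD scalerN.
move: y; apply: malg_ext => [a u v|a u v|j].
- exact: biliftPr.
- by rewrite /lie_part biliftPl opprD scalerN.
rewrite -!bvec_val !lie_bvec addrC -scaleNr -mulrNz; congr (_%:~R *: _).
by rewrite /det2; ring.
Qed.

Lemma mulC x y : mul_part x y = mul_part y x.
Proof.
move: x; apply: malg_ext => [a u v|a u v|i]; try exact: biliftPl.
  exact: biliftPr.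
move: y; apply: malg_ext => [a u v|a u v|j]; try exact: biliftPl.
  exact: biliftPr.
by rewrite /mul_part !biliftUU addrC.
Qed.

Lemma trilinear_ext (f g : M -> M -> M -> M) :
  (forall y z, linear (fun x => f x y z)) ->
  (forall x z, linear (fun y => f x y z)) ->
  (forall x y, linear (f x y)) ->
  (forall y z, linear (fun x => g x y z)) ->
  (forall x z, linear (fun y => g x y z)) ->
  (forall x y, linear (g x y)) ->
  (forall i j k : Z2star, f (bvec (val i)) (bvec (val j)) (bvec (val k)) =
                          g (bvec (val i)) (bvec (val j)) (bvec (val k))) ->
  forall x y z, f x y z = g x y z.
Proof.
move=> f1 f2 f3 g1 g2 g3 fg x y z.
move: x; apply: malg_ext => // i; move: y; apply: malg_ext => // j.
move: z; apply: malg_ext => // k.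
by rewrite -!bvec_val fg.
Qed.

Lemma lie_jacobi x y z : lie_part x (lie_part y z) =
  lie_part (lie_part x y) z + lie_part y (lie_part x z).
Proof.
apply: (trilinear_ext (f := fun x y z => lie_part x (lie_part y z))
  (g := fun x y z => lie_part (lie_part x y) z + lie_part y (lie_part x z)));
  try by move=> ? ? a u v; rewrite /lie_part !biE ?scalerDr // addrACA.
move=> i j k; set m := val i; set n := val j; set l := val k.
rewrite !lie_bvec /lie_part !biE -/lie_part !lie_bvec !scalerA.
rewrite addrA -[n + (m + l)]addrCA [m + (n + l)]addrA -scalerDl.
by rewrite -!intrM -intrD; congr (_%:~R *: _); rewrite /det2 /=; ring.
Qed.

Lemma lie_mul x y z : lie_part x (mul_part y z) =
  mul_part (lie_part x y) z + mul_part y (lie_part x z).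
Proof.
apply: (trilinear_ext (f := fun x y z => lie_part x (mul_part y z))
  (g := fun x y z => mul_part (lie_part x y) z + mul_part y (lie_part x z)));
  try by move=> ? ? a u v; rewrite /lie_part /mul_part !biE ?scalerDr // addrACA.
move=> i j k; rewrite mul_bvec ?(valP j) ?(valP k) // !lie_bvec.
set m := val i; set n := val j; set l := val k.
have n0 : n != 0 := valP j; have l0 : l != 0 := valP k.
rewrite /mul_part !biE -/mul_part !mul_bvec_scale; first last.
- by move/eqP; rewrite (negPf l0).
- by move/eqP; rewrite addr_eq0 => /eqP ->; rewrite /det2 /=; ring.
- move/eqP; rewrite addr_eq0 => /eqP ->; rewrite /det2 /=; ring.
- by move/eqP; rewrite (negPf n0).
rewrite [n + (m + l)]addrCA addrA -scalerDl -intrD.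
by congr (_%:~R *: _); rewrite /det2 /=; ring.
Qed.

Lemma lie_mul_cycle x y z : lie_part x (mul_part y z) =
  lie_part (mul_part x y) z - lie_part y (mul_part x z).
Proof.
apply: (trilinear_ext (f := fun x y z => lie_part x (mul_part y z))
  (g := fun x y z => lie_part (mul_part x y) z - lie_part y (mul_part x z)));
  try by move=> ? ? a u v; rewrite /lie_part /mul_part !biE ?scalerBr ?opprD //
    addrACA.
move=> i j k; rewrite !mul_bvec ?(valP i) ?(valP j) ?(valP k) // !lie_bvec.
set m := val i; set n := val j; set l := val k.
rewrite [n + (m + l)]addrCA addrA -scalerBl -intrB.
by congr (_%:~R *: _); rewrite /det2 /=; ring.
Qed.

Let d_homog0 p : double_homog p 0.
Proof. by case: p. Qed.

Let d_homogP p (a : K) (u v : virasoro_double) :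
  double_homog p u -> double_homog p v -> double_homog p (a *: u + v).
Proof. by case: p => /= -> ->; rewrite scaler0 addr0. Qed.

Let d_homog_span (u : virasoro_double) : exists u0 u1,
  [/\ double_homog false u0, double_homog true u1 & u = u0 + u1].
Proof.
exists (u.1, 0), (0, u.2); split=> //.
by case: u => a b; congr pair; rewrite /= ?addr0 ?add0r.
Qed.

Let d_homog_direct (u : virasoro_double) :
  double_homog false u -> double_homog true u -> u = 0.
Proof. by case: u => a b /= -> ->. Qed.

Let d_bracketPl (a : K) u v w :
  double_bracket (a *: u + v) w = a *: double_bracket u w + double_bracket v w.
Proof.
by congr pair; rewrite /lie_part /mul_part /= !biE scalerDr addrACA.
Qed.

Let d_bracketPr (a : K) u v w :
  double_bracket w (a *: u + v) = a *: double_bracket w u + double_bracket w v.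
Proof.
by congr pair; rewrite /lie_part /mul_part /= !biE scalerDr addrACA.
Qed.

Let d_homog_bracket p q u v : double_homog p u -> double_homog q v ->
  double_homog (p (+) q) (double_bracket u v).
Proof.
by case: p; case: q => /= -> ->; rewrite /lie_part /mul_part !biE addr0.
Qed.

Let d_bracketC p q u v : double_homog p u -> double_homog q v ->
  double_bracket u v = - ((-1) ^+ (p && q) *: double_bracket v u).
Proof.
case: u v => [u0 u1] [v0 v1].
case: p; case: q => /= -> ->; rewrite ?scaleN1r ?scale1r; congr pair;
  rewrite /= ?opprK /lie_part /mul_part !biE ?addr0 ?add0r ?oppr0 //
    -/lie_part -/mul_part; by [exact: mulC | exact: lieC].
Qed.

Lemma part0 :
  ((forall x, lie_part 0 x = 0) * (forall x, lie_part x 0 = 0)) *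
  ((forall x, mul_part 0 x = 0) * (forall x, mul_part x 0 = 0)).
Proof.
by split; split=> x; rewrite /lie_part /mul_part ?bilift0l ?bilift0r.
Qed.

Lemma mul_lie x y z : mul_part x (lie_part y z) =
  mul_part (lie_part x y) z + lie_part y (mul_part x z).
Proof.
rewrite lie_mul addrA [lie_part x y]lieC /mul_part -biliftDl addNr.
by rewrite bilift0l add0r.
Qed.

Lemma mul_lie_cycle x y z : mul_part x (lie_part y z) =
  lie_part (mul_part x y) z - mul_part y (lie_part x z).
Proof.
have N u v : mul_part u (- v) = - mul_part u v.
  by rewrite -scaleN1r /mul_part biliftZr scaleN1r.
rewrite [lie_part (mul_part x y) z]lieC lie_mul [lie_part x z]lieC N opprK.
rewrite [lie_part y z]lieC N [mul_part (lie_part z x) y]mulC opprD addrAC.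
by rewrite addNr add0r.
Qed.

Let d_jacobi p q u v w : double_homog p u -> double_homog q v ->
  double_bracket u (double_bracket v w) =
  double_bracket (double_bracket u v) w +
  (-1) ^+ (p && q) *: double_bracket v (double_bracket u w).
Proof.
case: u v w => [u0 u1] [v0 v1] [w0 w1].
case: p; case: q => /= -> ->;
  rewrite ?scaleN1r ?scale1r; congr pair;
  rewrite /= !(part0, addr0, add0r, oppr0) //;
  by [exact: lie_jacobi | exact: lie_mul | exact: lie_mul_cycle
    | exact: mul_lie | exact: mul_lie_cycle].
Qed.

HB.instance Definition _ := Lmodule_isLieSuperalgebra.Build K virasoro_double
  d_homog0 d_homogP d_homog_span d_homog_direct d_bracketPl d_bracketPr
  d_homog_bracket d_bracketC d_jacobi.

Lemma double_LG0 : (double_L 0 = 0) * (double_G 0 = 0).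
Proof. by rewrite /double_L /double_G bvec0. Qed.

Lemma sbracketLL m n :
  sbracket (double_L m) (double_L n) = (det2 n m)%:~R *: double_L (m + n).
Proof.
by congr pair; rewrite /= ?lie_bvec !(part0, addr0, scaler0).
Qed.

Lemma sbracketLG m n :
  sbracket (double_L m) (double_G n) = (det2 n m)%:~R *: double_G (m + n).
Proof.
by congr pair; rewrite /= ?lie_bvec !(part0, addr0, scaler0).
Qed.

Lemma sbracketGL m n :
  sbracket (double_G m) (double_L n) = (det2 n m)%:~R *: double_G (m + n).
Proof.
by congr pair; rewrite /= ?lie_bvec !(part0, add0r, scaler0).
Qed.

Lemma sbracketGG m n : m != 0 -> n != 0 ->
  sbracket (double_G m) (double_G n) = double_L (m + n).
Proof.
move=> m0 n0.
by congr pair; rewrite /= ?mul_bvec // !(part0, add0r).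
Qed.

End Double.

(* Main.v *)
(* An odd (-1)-superderivation is a pair of maps, [A] from the even to the odd
   part and [B] back.  The (even, even) brackets make [A] a (-1)-derivation of the
   Virasoro-like algebra, which vanishes by looking at its homogeneous components
   for the Z^2-grading.  Then the (even, odd) brackets say that [B] anticommutes
   with all [ad x], so [B = 0] because the algebra is perfect and centerless. *)
Require Import Defs.
From mathcomp Require Import all_boot all_order all_algebra.
From mathcomp Require Import ring zify.
From mathcomp Require Import classical_sets functions reals complex.
From mathcomp Require Import finmap monalg.

Set Implicit Arguments.
Unset Strict Implicit.
Unset Printing Implicit Defensive.

Import GRing.Theory Num.Theory.
Local Open Scope ring_scope.
Local Open Scope classical_set_scope.

(** * Bilinearity of the determinant, and indices transversal to a given one *)

Lemma det2D m n p : det2 (m + n) p = det2 m p + det2 n p.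
Proof. by rewrite /det2 /=; ring. Qed.

Lemma det2N m p : det2 (- m) p = - det2 m p.
Proof. by rewrite /det2 /=; ring. Qed.

Lemma det2C m n : det2 m n = - det2 n m.
Proof. by rewrite /det2; ring. Qed.

Lemma det2_self m : det2 m m = 0.
Proof. by rewrite /det2; ring. Qed.

Lemma det2Dr m n p : det2 p (m + n) = det2 p m + det2 p n.
Proof. by rewrite det2C det2D opprD -!(det2C p). Qed.

Lemma det2Nr m p : det2 p (- m) = - det2 p m.
Proof. by rewrite det2C det2N -(det2C p). Qed.

Definition det2E := (det2D, det2N, det2Dr, det2Nr, det2_self).

(** Quarter turn: [det2 m (rot k)] is the Euclidean inner product of [m] and [k], so [rot m] is an
    index transversal to any nonzero [m]. *)
Definition rot (m : Z2) : Z2 := (- m.2, m.1).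

Lemma det2_rot_neq0 k m : k != 0 -> m != 0 -> det2 k m = 0 ->
  det2 m (rot k) != 0.
Proof.
case: k m => [k1 k2] [m1 m2]; rewrite /det2 /rot !xpair_eqE /=.
move=> k0 m0 km; apply/negP => /eqP kr.
(* Lagrange's identity: the squared determinant plus the squared inner product is the product of the
   squared norms. *)
have: (k1 * k1 + k2 * k2) * (m1 * m1 + m2 * m2) = 0.
  transitivity ((k1 * m2 - k2 * m1) ^+ 2 + (m1 * k1 - m2 * - k2) ^+ 2).
    by ring.
  by rewrite km kr.
move/eqP; rewrite mulf_eq0.
have norm0 (x y : int) : ~~ ((x == 0) && (y == 0)) -> x * x + y * y != 0.
  by nia.
by rewrite (negPf (norm0 _ _ k0)) (negPf (norm0 _ _ m0)).
Qed.

Lemma det2_self_rot_neq0 m : m != 0 -> det2 m (rot m) != 0.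
Proof. by move=> m0; apply: det2_rot_neq0; rewrite ?det2_self. Qed.

(** * Coefficients in the basis, and the center *)

Section Coefficients.
Variable K : numFieldType.
Local Notation M := {malg K[Z2star]}.
Implicit Types (x y u : M) (m n k : Z2).

(* The value 0 at the index 0 matches the convention [bvec 0 = 0]. *)
Definition coef u m : K := if insub m is Some i then u@_i else 0.

Lemma coef_linear m : linear (fun u => coef u m : K^o).
Proof.
move=> a u v; rewrite /coef; case: insubP => [i _ _|_].
  by rewrite mcoeffD mcoeffZ.
by rewrite scaler0 addr0.
Qed.

Lemma coef0 m : coef 0 m = 0.
Proof. by rewrite /coef; case: insubP => // i _ _; rewrite mcoeff0. Qed.

Lemma coefD u v m : coef (u + v) m = coef u m + coef v m.
Proof. by have := coef_linear m 1 u v; rewrite !scale1r. Qed.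

Lemma coefZ a u m : coef (a *: u) m = a * coef u m.
Proof. by have := coef_linear m a u 0; rewrite addr0 coef0 addr0. Qed.

Lemma coefN u m : coef (- u) m = - coef u m.
Proof. by rewrite -scaleN1r coefZ mulN1r. Qed.

Lemma coef_at0 u : coef u 0 = 0.
Proof. by rewrite /coef insubN // eqxx. Qed.

Lemma coef_bvec m n : coef (bvec K m) n = ((m == n) && (m != 0))%:R.
Proof.
rewrite /coef /bvec.
case: insubP => [i ni <-|]; last first.
  by rewrite negbK => /eqP ->; case: eqVneq => // ->; rewrite eqxx.
case: insubP => [j mj <-|].
  by rewrite mcoeffU val_eqE (valP j) andbT.
by rewrite negbK => /eqP ->; rewrite eqxx andbF mcoeff0.
Qed.

Lemma coef_inj u v : coef u =1 coef v -> u = v.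
Proof.
by move=> uv; apply/malgP => i; have := uv (val i); rewrite /coef valK.
Qed.

Lemma coef_lie_bvec m u s :
  coef (lie_part (bvec K m) u) s = (det2 s m)%:~R * coef u (s - m).
Proof.
move: u; apply: (@malg_ext K Z2star K^o) => [a u v|a u v|i] /=.
- by rewrite /lie_part biliftPr coefD coefZ.
- by rewrite coefD coefZ mulrDr mulrCA.
rewrite -bvec_val lie_bvec coefZ !coef_bvec (valP i) andbT.
(* At the index 0 the convention is consistent: the factor [det2 0 m] vanishes too. *)
have [s0|s0] := eqVneq s 0.
  rewrite s0 sub0r (_ : det2 0 m = 0) ?mul0r; last by rewrite /det2 /=; ring.
  by rewrite andbN mulr0.
rewrite addrC -subr_eq opprK; rewrite -[_ == s](inj_eq (addIr (- m))) addrK.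
case: eqVneq => [->|]; last by rewrite !mulr0.
by rewrite subrK s0 !det2E subr0.
Qed.

Lemma coef_lie_bvecr m u s :
  coef (lie_part u (bvec K m)) s = - (det2 s m)%:~R * coef u (s - m).
Proof. by rewrite lieC coefN coef_lie_bvec mulNr. Qed.

(** Bracketing with [bvec (rot k)] moves the coefficient of [u] at [k] to the index [k + rot k] and
    multiplies it by the nonzero integer [det2 k (rot k)]. *)
Lemma lie_center0 u : (forall m, lie_part (bvec K m) u = 0) -> u = 0.
Proof.
move=> u0; apply: coef_inj => k; rewrite coef0.
have [->|k0] := eqVneq k 0; first exact: coef_at0.
have := coef_lie_bvec (rot k) u (k + rot k).
rewrite u0 coef0 addrK det2E det2_self addr0 => /esym/eqP.
by rewrite mulf_eq0 intr_eq0 (negPf (det2_self_rot_neq0 k0)) => /eqP.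
Qed.

(** Reduces a goal to [c] times a known equation; the remaining identity is for [ring]. *)
Lemma lincomb (c p q x y : K) : p = q -> x - y = c * (p - q) -> x = y.
Proof. by move=> -> /eqP; rewrite subrr mulr0 subr_eq0 => /eqP. Qed.
Arguments lincomb c {p q x y}.

(* [a m] stands for the coefficient at [m + k] of the image of [bvec m] under a
   (-1)-derivation of the Virasoro-like algebra. *)
Section HomogeneousComponent.
Variables (k : Z2) (a : Z2 -> K).
Hypothesis aE : forall m n, (det2 n m)%:~R * (a (m + n) + a m + a n) =
  (det2 k n)%:~R * a m - (det2 k m)%:~R * a n.

(** Apply [aE] to the parallel pair [m], [m + m]: the left-hand side vanishes. *)
Lemma component_double m : det2 k m != 0 -> a (m + m) = 2 * a m.
Proof.
move=> km; have d0 : (det2 k m)%:~R != 0 :> K by rewrite intr_eq0.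
have := aE m (m + m); rewrite !det2E addr0 mul0r => e.
by apply: (mulfI d0); apply: (lincomb 1 e); ring.
Qed.

(* Comparing [aE] at (m, n) and at (2m, 2n): the two sides scale by 8 and 4. *)
Lemma component_transversal_split m n :
  det2 k m != 0 -> det2 k n != 0 -> det2 k (m + n) != 0 ->
  (det2 k n)%:~R * a m = (det2 k m)%:~R * a n /\
  (det2 n m)%:~R * (a (m + n) + a m + a n) = 0.
Proof.
move=> km kn kmn; have e1 := aE m n; have e2 := aE (m + m) (n + n).
have e : (det2 n m)%:~R * (a (m + n) + a m + a n) = 0.
  move: e2; rewrite addrACA !component_double // !det2E => e2.
  have four0 : 4 != 0 :> K by rewrite pnatr_eq0.
  apply: (mulfI four0).
  have {e2} := f_equal2 (fun x y : K => x - 4 * y) e2 e1.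
  by move=> e; apply: (lincomb 1 e); ring.
by split=> //; apply/eqP; rewrite -subr_eq0 -e1 e.
Qed.

Lemma component_transversal s : det2 k s != 0 -> a s = 0.
Proof.
move=> ks; have d0 : (det2 k s)%:~R != 0 :> K by rewrite intr_eq0.
have two0 : 2 != 0 :> K by rewrite pnatr_eq0.
(* With d = [det2 k s], this splits [s] as [m + n] where [det2 k m] = -d, [det2 k n] = 2d and
   [det2 n m] = -d. The pairs (m, n) and (n, s) then give [a n = 2 * a s], [a m = - a s] and
   [a s + a m + a n = 0], so [2 * a s = 0]. *)
set m := k - s; set n := s + s - k.
have km : det2 k m = - det2 k s by rewrite !det2E add0r.
have kn : det2 k n = det2 k s + det2 k s by rewrite !det2E subr0.
have nm : det2 n m = - det2 k s.
  by rewrite !det2E (det2C s k); ring.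
have mn : m + n = s by rewrite /m /n addrC addrA subrK addrK.
have ks2 : det2 k s + det2 k s != 0 by rewrite -mulr2n mulrn_eq0.
have [e1 e2] : (det2 k n)%:~R * a m = (det2 k m)%:~R * a n /\
  (det2 n m)%:~R * (a (m + n) + a m + a n) = 0.
  by apply: component_transversal_split; rewrite ?mn ?km ?kn ?oppr_eq0.
have [e3 _] : (det2 k s)%:~R * a n = (det2 k n)%:~R * a s /\
  (det2 s n)%:~R * (a (n + s) + a n + a s) = 0.
  apply: component_transversal_split; rewrite ?kn // det2Dr kn.
  by rewrite -mulr2n -mulrSr mulrn_eq0.
move: e1 e2 e3; rewrite mn km kn nm => e1 e2 e3.
have {e3}an : a n = 2 * a s by apply: (mulfI d0); rewrite e3; ring.
rewrite an in e1 e2.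
have am : a m = - a s.
  by apply: (mulfI two0); apply: (mulfI d0); apply: (lincomb 1 e1); ring.
rewrite am in e2.
by apply: (mulfI two0); apply: (mulfI d0); apply: (lincomb (-1) e2); ring.
Qed.

(* Two evaluations of [a (2m + 2n)] give [a m = a n] for n transversal to m, and
   two evaluations of [a (2m + n)] then give [6 a m = 0]. *)
Lemma component_degree0 m : k = 0 -> m != 0 -> a m = 0.
Proof.
move=> k0 m0; have two0 : 2 != 0 :> K by rewrite pnatr_eq0.
have := det2_self_rot_neq0 m0; set n := rot m => mn.
have nm : det2 n m != 0 by rewrite det2C oppr_eq0.
(* For [k = 0] the right-hand side of [aE] is zero, so [a] is additive up to sign on non-parallel
   pairs; [c] measures their determinant against that of [n] and [m]. *)
have add (c : int) p q : det2 q p = c * det2 n m -> c != 0 ->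
    a (p + q) = - a p - a q.
  move=> qp c0; have := aE p q.
  have -> : det2 k q = 0 by rewrite k0 /det2 /=; ring.
  have -> : det2 k p = 0 by rewrite k0 /det2 /=; ring.
  have d0 : (det2 q p)%:~R != 0 :> K by rewrite intr_eq0 qp mulf_neq0.
  by move=> e; apply: (mulfI d0); apply: (lincomb 1 e); ring.
have a1 : a (m + n) = - a m - a n.
  by apply: (add 1); rewrite ?mul1r.
have a2 : a (m + n + n) = a m.
  by rewrite (add 1) ?a1 // ?det2E; ring.
have a3 : a (m + (m + n)) = a n.
  by rewrite (add 1) ?a1 // ?det2E; ring.
have a4 : a m = a n.
  have : a (m + (m + n + n)) = a (m + (m + n) + n) by congr a; rewrite !addrA.
  rewrite [LHS](add 2) // ?det2E; last by ring.
  rewrite [RHS](add 2) // ?det2E; last by ring.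
  rewrite a2 a3 => e; apply: (mulfI two0).
  by apply: (lincomb (-1) e); ring.
have a5 : a (m - n) = - a m - a n.
  have := add 1 (m - n) n; rewrite subrK !det2E subr0 mul1r => /(_ erefl isT) e.
  by apply: (lincomb 1 e); ring.
have a6 : a (m + m) = 4 * a m.
  (* [add] does not apply to the parallel pair (m, m), but it does to [m - n] and [m + n]. *)
  have -> : m + m = (m - n) + (m + n) by rewrite addrACA addNr addr0.
  by rewrite (add 2) ?a1 ?a5 -?a4 // ?det2E ?(det2C m n); ring.
have a7 : a (m + m + n) = a m by rewrite -addrA a3 a4.
move: a7; rewrite (add 2) ?a6 -?a4 // ?det2E => [e|]; last by ring.
have six0 : 6 != 0 :> K by rewrite pnatr_eq0.
by apply: (mulfI six0); apply: (lincomb (-1) e); ring.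
Qed.

(** The remaining case is a nonzero [m] parallel to [k != 0]: write it as [s + (m - s)] with
    [s = rot k]. Both summands are transversal to [k], where [a] vanishes, and they are not parallel
    to each other. *)
Lemma component_eq0 m : m != 0 -> a m = 0.
Proof.
have [k0|k0] := eqVneq k 0; first exact: component_degree0.
move=> m0.
have [km|] := eqVneq (det2 k m) 0; last exact: component_transversal.
have ms := det2_rot_neq0 k0 m0 km.
set s := rot k in ms; have ks : det2 k s != 0 := det2_self_rot_neq0 k0.
have kt : det2 k (m - s) != 0 by rewrite !det2E km add0r oppr_eq0.
have sm : s + (m - s) = m by rewrite addrC subrK.
have := aE s (m - s).
rewrite sm (component_transversal ks) (component_transversal kt) !mulr0.
rewrite !addr0 subr0 !det2E subr0 => /eqP.
by rewrite mulf_eq0 intr_eq0 (negPf ms) => /eqP.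
Qed.

End HomogeneousComponent.

(** * Antiderivations and anticommuting maps of the Virasoro-like algebra *)

Lemma antiderivation_eq0 (A : M -> M) : linear A ->
  (forall x y, A (lie_part x y) = - (lie_part (A x) y + lie_part x (A y))) ->
  forall x, A x = 0.
Proof.
move=> Al Ader; apply: malg_ext => // [b u v|i]; first by rewrite scaler0 addr0.
have AZ b u : A (b *: u) = b *: A u.
  have A0 : A 0 = 0 by have := Al (-1) 0 0; rewrite scaler0 addr0 scaleN1r addNr.
  by have := Al b u 0; rewrite A0 !addr0.
rewrite -bvec_val; apply: coef_inj => s; rewrite coef0.
(* The coefficient at [s] belongs to the component of [A] of degree [k = s - val i]. As the bracket
   is graded, comparing coefficients at [m + n + k] gives [aE] for this component alone. *)
have -> : s = val i + (s - val i) by rewrite addrC subrK.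
set k := s - val i.
apply: (@component_eq0 k (fun m => coef (A (bvec K m)) (m + k))) (valP i).
move=> m n.
have := congr1 (fun u => coef u (m + n + k)) (Ader (bvec K m) (bvec K n)).
rewrite lie_bvec AZ coefN coefD !coefZ coef_lie_bvec coef_lie_bvecr.
have -> : m + n + k - n = m + k by rewrite addrAC addrK.
have -> : m + n + k - m = n + k by rewrite [m + n]addrC addrAC addrK.
rewrite !det2E (det2C m n) => e.
by apply: (lincomb 1 e); ring.
Qed.

(* [B] anticommutes with each [ad x]; hence it both commutes and anticommutes
   with [ad (lie_part x y)], and the algebra is perfect and centerless. *)
Lemma anticentroid_eq0 (B : M -> M) : linear B ->
  (forall x y, B (lie_part x y) = - lie_part x (B y)) -> forall x, B x = 0.
Proof.
move=> Bl Bac z.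
have BD u v : B (u + v) = B u + B v by have := Bl 1 u v; rewrite !scale1r.
have lN u v : lie_part u (- v) = - lie_part u v.
  by rewrite -scaleN1r /lie_part biliftZr scaleN1r.
have comm x y : lie_part (lie_part x y) (B z) = 0.
  (* Passing [B] through two brackets restores the sign. Jacobi for [z] under [B], compared with
     Jacobi for [B z], then makes [lie_part (lie_part x y) (B z)] equal to its opposite. *)
  have Bac2 u v w : B (lie_part u (lie_part v w)) = lie_part u (lie_part v (B w)).
    by rewrite (Bac u) (Bac v) lN opprK.
  have := congr1 B (lie_jacobi x y z).
  rewrite (BD (lie_part (lie_part x y) z)) (Bac (lie_part x y)) !Bac2.
  rewrite (lie_jacobi x y (B z)) => /addIr e.
  have two0 : 2 != 0 :> K by rewrite pnatr_eq0.
  by apply: (scalerI two0); rewrite scaler0 scaler_nat mulr2n {1}e addNr.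
apply: lie_center0 => m.
have [->|m0] := eqVneq m 0; first by rewrite bvec0 part0.
(* Perfectness: the bracket of these two basis vectors is a nonzero multiple of [bvec m]. *)
have := comm (bvec K (m - rot m)) (bvec K (rot m)).
rewrite lie_bvec subrK /lie_part biliftZl => /eqP.
rewrite scaler_eq0 intr_eq0 !det2E subr0 det2C oppr_eq0.
by rewrite (negPf (det2_self_rot_neq0 m0)) => /eqP.
Qed.

(** * From the double to its even and odd components *)

Lemma sbracket_ee x y :
  sbracket ((x, 0) : virasoro_double K) (y, 0) = (lie_part x y, 0).
Proof. by congr pair; rewrite /= !(part0, addr0). Qed.

Lemma sbracket_eo x y :
  sbracket ((x, 0) : virasoro_double K) (0, y) = (0, lie_part x y).
Proof. by congr pair; rewrite /= !(part0, addr0). Qed.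

Lemma sbracket_oe x y :
  sbracket ((0, x) : virasoro_double K) (y, 0) = (0, lie_part x y).
Proof. by congr pair; rewrite /= !(part0, add0r). Qed.

Lemma sbracket_oo x y :
  sbracket ((0, x) : virasoro_double K) (0, y) = (mul_part x y, 0).
Proof. by congr pair; rewrite /= !(part0, add0r). Qed.

End Coefficients.

Theorem theorem4p5 (R : realType) :
  superderivations (virasoro_double R[i]) (-1) true = [set 0].
Proof.
apply/seteqP; split=> [D [Dl Dh Dder]|_ ->] /=; last first.
  split=> [a u v|p x _|p q x y _ _].
  - by rewrite scaler0 addr0.
  - exact: homog0.
  - have s0l (v : virasoro_double R[i]) : sbracket 0 v = 0.
      by have := sbracketPl (-1) 0 0 v; rewrite scaler0 addr0 scaleN1r addNr.
    have s0r (v : virasoro_double R[i]) : sbracket v 0 = 0.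
      by have := sbracketPr (-1) 0 0 v; rewrite scaler0 addr0 scaleN1r addNr.
    by rewrite s0l s0r scaler0 addr0 scaler0.
set K := R[i] in D Dl Dh Dder *.
(* Oddness makes [D] off-diagonal, so [A] and [B] determine it. *)
pose A x := (D (x, 0)).2; pose B x := (D (0, x)).1.
have DA x : D (x, 0) = (0, A x).
  have : (D (x, 0)).1 = 0 by apply: (Dh false).
  by rewrite /A; case: (D _) => u v /= ->.
have DB x : D (0, x) = (B x, 0).
  have : (D (0, x)).2 = 0 by apply: (Dh true).
  by rewrite /B; case: (D _) => u v /= ->.
have Al : linear A.
  move=> a u v; rewrite /A -[RHS]/((a *: D (u, 0) + D (v, 0)).2) -Dl.
  by congr (D _).2; congr pair; rewrite /= scaler0 addr0.
have Bl : linear B.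
  move=> a u v; rewrite /B -[RHS]/((a *: D (0, u) + D (0, v)).1) -Dl.
  by congr (D _).1; congr pair; rewrite /= scaler0 addr0.
have A0 : forall x, A x = 0.
  apply: (antiderivation_eq0 Al) => x y.
  have := Dder false false (x, 0) (y, 0) erefl erefl.
  rewrite (sbracket_ee x y) (DA (lie_part x y)) (DA x) (DA y).
  rewrite (sbracket_oe (A x) y) (sbracket_eo x (A y)) => /(congr1 snd) e.
  have {e} : A (lie_part x y) =
      -1 *: (lie_part (A x) y + (-1) ^+ 0 *: lie_part x (A y)) := e.
  by rewrite expr0 scale1r scaleN1r.
have B0 : forall x, B x = 0.
  apply: (anticentroid_eq0 Bl) => x y.
  (* Since [A = 0], the product term drops out and only the anticommutation with [lie_part x]
     remains; the sign is trivial because [x] is even. *)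
  have := Dder false true (x, 0) (0, y) erefl erefl.
  rewrite (sbracket_eo x y) (DB (lie_part x y)) (DA x) (DB y) A0.
  rewrite (sbracket_oo 0 y) (sbracket_ee x (B y)) => /(congr1 fst) e.
  have {e} : B (lie_part x y) =
      -1 *: (mul_part 0 y + (-1) ^+ 0 *: lie_part x (B y)) := e.
  by rewrite part0 add0r expr0 scale1r scaleN1r.
apply/boolp.funext => -[u v].
have -> : (u, v) = 1 *: ((u, 0) : virasoro_double K) + (0, v).
  by rewrite scale1r; congr pair; rewrite /= ?addr0 ?add0r.
by rewrite Dl DA DB A0 B0 scaler0 addr0.
Qed.
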